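(* Let $(U_n)_{n\in\mathbb{N}}=(R_n,B_n)_{n\in\mathbb{N}}$ be the tenable two-strategy urn process with parameters $p,\theta\in[0,1]$, replacement matrix entries $a,b,c,d$ and balance $K=a+b=c+d$, as defined in the context, and let $T_n=Kn+T_0$ be the total number of balls at time $n$. If $\theta(2p-1)(a-c)<K$, then almost surely $$\lim_{n\to\infty}\left(\frac{R_n}{T_n},\frac{B_n}{T_n}\right)=\left(\frac{pc+(1-p)a}{K-\theta(2p-1)(a-c)},\ \frac{K-c-(a-c)\big(\theta(2p-1)+(1-p)\big)}{K-\theta(2p-1)(a-c)}\right).$$
   Context: Two-strategy urn process. An urn contains red and blue balls; $R_n$ and $B_n$ denote the numbers of red and blue balls at time $n$, starting from $R_0$ red and $B_0$ blue balls, with $T_0=R_0+B_0$. The replacement matrix is $$M=\begin{pmatrix} a & c\\ b & d\end{pmatrix},\qquad \vec R=(a,b)^T,\quad \vec B=(c,d)^T .$$ Using column $\vec R$ means adding $a$ red and $b$ blue balls; using column $\vec B$ means adding $c$ red and $d$ blue balls. The urn is balanced: $a+b=c+d=K$, so the total number of balls is $T_n=R_n+B_n=Kn+T_0$. Dynamics, with parameters $p,\theta\in[0,1]$: let $(Y_n)_{n\ge0}$ be an i.i.d. Bernoulli($\theta$) sequence, where $Y_n$ (independent of the urn history up to time $n$) determines who plays at the step from $n$ to $n+1$. If $Y_n=1$, player $\mathcal A$ draws a ball uniformly at random from the urn, observes its color and returns it, then chooses the same color with probability $p$ and the opposite color with probability $1-p$. If $Y_n=0$, player $\mathcal B$ chooses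 blue with probability $p$ and red with probability $1-p$, independently of the urn composition. If the chosen color is red, column $\vec R$ is added; if it is blue, column $\vec B$ is added. Equivalently, $$\mathbb P(R_{n+1}=r+a\mid R_n=r,Y_n=y)=1-p+(2p-1)\,y\,\frac{r}{T_n},$$ $$\mathbb P(R_{n+1}=r+c\mid R_n=r,Y_n=y)=1-\mathbb P(R_{n+1}=r+a\mid R_n=r,Y_n=y),$$ and $B_n=T_n-R_n$. The urn is called tenable if: (a) $T_0>0$; (b) $T_n=Kn+T_0$ for some $K\ge1$; (c) $a\ne c$; (d) all entries $a,b,c,d$ are non-negative. All ball counts are integers. *)

(* Defs.v *)
From HB Require Import structures.
From mathcomp Require Import all_boot all_order all_algebra ring.
From mathcomp Require Import all_classical all_reals all_analysis.
Import Order.TTheory GRing.Theory Num.Theory.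
Import numFieldNormedType.Exports.

Set Implicit Arguments.
Unset Strict Implicit.
Unset Printing Implicit Defensive.

Local Open Scope classical_set_scope.
Local Open Scope ring_scope.

Definition cond_prob d (Omega : measurableType d) (R : realType)
    (P : probability Omega R) (A H : set Omega) : R :=
  fine (P (A `&` H)) / fine (P H).

(* Mutual independence: the product rule for every finite subfamily. *)
Definition mutually_independent d (Omega : measurableType d) (R : realType)
    (P : probability Omega R) d' (T : measurableType d')
    (X : nat -> {RV P >-> T}) : Prop :=
  forall (J : seq nat) (E : nat -> set T), uniq J ->
    (forall j, measurable (E j)) ->
    P (\bigcap_(j in [set` J]) (X j @^-1` E j)) =
    (\prod_(j <- J) P (X j @^-1` E j))%E.

Definition iid_bernoulli d (Omega : measurableType d) (R : realType)
    (P : probability Omega R) (theta : R) (Y : nat -> {RV P >-> bool}) : Prop :=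
  mutually_independent Y /\
  forall n (A : set bool), distribution P (Y n) A = bernoulli_prob theta A.

(* The columns of the replacement matrix are (a, b) for red, (c, d) for blue;
   counts and matrix entries are natural numbers, i.e. nonnegative integers. *)
Record tenable (a b c d R0 B0 K : nat) : Prop := Tenable {
  tenable_start : (0 < R0 + B0)%N ;
  tenable_K : (1 <= K)%N ;
  tenable_red : (a + b = K)%N ;
  tenable_blue : (c + d = K)%N ;
  tenable_neq : a <> c }.

Definition total_balls (R0 B0 K n : nat) : nat := (K * n + (R0 + B0))%N.

(* Probability that the red column is used, when player y (true for the player
   who draws a ball) faces r red balls out of t. *)
Definition red_prob (R : realType) (p : R) (y : bool) (r t : nat) : R :=
  1 - p + (2 * p - 1) * y%:R * (r%:R / t%:R).

Lemma red_probE (R : realType) (p : R) (y : bool) (r t : nat) :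
  red_prob p y r t =
  if y then p * (r%:R / t%:R) + (1 - p) * (1 - r%:R / t%:R) else 1 - p.
Proof. by rewrite /red_prob; case: y => /=; ring. Qed.

(* The event that the past up to time n, strictly before Y_n, is
   R_k = r k (k <= n) and Y_k = y k (k < n). The blue counts are omitted since
   they are determined by the red ones. *)
Definition past d (Omega : measurableType d) (R : realType)
    (P : probability Omega R) (Y : nat -> {RV P >-> bool})
    (Rn : nat -> {RV P >-> nat}) (n : nat) (r : nat -> nat) (y : nat -> bool) :
    set Omega :=
  [set w | (forall k, (k <= n)%N -> Rn k w = r k) /\
           (forall k, (k < n)%N -> Y k w = y k)].

Definition present d (Omega : measurableType d) (R : realType)
    (P : probability Omega R) (Y : nat -> {RV P >-> bool})
    (Rn : nat -> {RV P >-> nat}) (n : nat) (r : nat -> nat) (y : nat -> bool) :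
    set Omega :=
  past Y Rn n r y `&` (Y n @^-1` [set y n]).

Record two_strategy_urn d (Omega : measurableType d) (R : realType)
    (P : probability Omega R) (p theta : R) (a c R0 B0 K : nat)
    (Y : nat -> {RV P >-> bool}) (Rn Bn : nat -> {RV P >-> nat}) : Prop :=
  TwoStrategyUrn {
  urn_start : forall w, Rn 0%N w = R0 ;
  urn_total : forall n w, (Rn n w + Bn n w)%N = total_balls R0 B0 K n ;
  urn_strategy : iid_bernoulli theta Y ;
  urn_independent : forall n r y (A : set bool),
    P (past Y Rn n r y `&` (Y n @^-1` A)) =
    (P (past Y Rn n r y) * P (Y n @^-1` A))%E ;
  urn_red : forall n r y, (0 < P (present Y Rn n r y))%E ->
    cond_prob P (Rn n.+1 @^-1` [set (r n + a)%N]) (present Y Rn n r y) =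
    red_prob p (y n) (r n) (total_balls R0 B0 K n) ;
  urn_blue : forall n r y, (0 < P (present Y Rn n r y))%E ->
    cond_prob P (Rn n.+1 @^-1` [set (r n + c)%N]) (present Y Rn n r y) =
    1 - cond_prob P (Rn n.+1 @^-1` [set (r n + a)%N]) (present Y Rn n r y) }.

(* Main.v *)
Require Import Defs.
From HB Require Import structures.
From mathcomp Require Import all_boot all_order all_algebra.
From mathcomp Require Import all_classical all_reals all_analysis.
From mathcomp Require Import measurable_realfun ring lra.
Import Order.TTheory GRing.Theory Num.Theory.
Import numFieldNormedType.Exports.
Local Open Scope classical_set_scope.
Local Open Scope ring_scope.

(** Write X_n = R_n / T_n for the proportion of red balls. Given the past, the
mean increment of R_n is mu + lam * X_n, with lam = theta (2p-1) (a-c) and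
mu = pc + (1-p)a, so the mean motion of X_n has the single rest point
rho = mu / (K - lam), and the deviation W_n = X_n - rho satisfies
E[W_{n+1} | past] = (T_n + lam) / T_{n+1} * W_n. The factor is
1 - (K - lam) / T_{n+1} with K - lam > 0, and the noise in one step has size
O(1/n); expanding the square gives
  E[W_{n+1}^2] <= E[W_n^2] - 2 (K - lam) T_n / T_{n+1}^2 E[W_n^2] + C / T_{n+1}^2
([deviation_moment_step]). The inequality telescopes: the sum of the
E[W_n^2] / n is finite, hence the sum of the W_n^2 / n is almost surely finite
([ae_summable_deviation]). Since each step adds a bounded number of balls to an
urn of size of order n, also |W_{n+1} - W_n| = O(1/n); a sequence that moves
this slowly and has a finite sum of W_n^2 / n must tend to 0
([square_summable_slow_cvg0]), which is a statement about a single path.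

The second moments only depend on the joint law of (R_n, R_{n+1}). The urn
dynamics prescribe it conditionally on each full history; as there are only
countably many histories up to time n, summing over them gives the law
conditionally on R_n alone ([Pr_disintegration], [Pr_mixture]). *)

(** * Slowly varying square-summable sequences *)

(** By comparison with the telescoping sum of 2 / ((k + 1) (k + 2)). *)
Lemma sum_inv_sqr_le2 (R : realType) n :
  \sum_(0 <= k < n) (k.+1%:R ^+ 2)^-1 <= 2 :> R.
Proof.
suff H : \sum_(0 <= k < n) (k.+1%:R ^+ 2)^-1 <= 2 - 2 / n.+1%:R :> R.
  by apply: (le_trans H); rewrite gerBl divr_ge0.
elim: n => [|n IH]; first by rewrite big_nil divr1 subrr.
rewrite big_nat_recr //=; apply: (le_trans (lerD IH (lexx _))).
have h1 : (0 : R) < n.+1%:R by rewrite ltr0n.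
have h2 : (1 : R) <= n.+1%:R by rewrite ler1n.
rewrite -addrA lerD2l -[n.+2]addn1 natrD.
set x : R := n.+1%:R in h1 h2 *.
have -> : - (2 / x) + (x ^+ 2)^-1 = - (2 / (x + 1)) - (x - 1) / (x ^+ 2 * (x + 1)).
  by field; rewrite gt_eqF // ?gt_eqF //; lra.
by rewrite gerBl divr_ge0 //; nra.
Qed.

Lemma nneg_series_bounded_cvg (R : realType) (u : R ^nat) (B : R) :
  (forall n, 0 <= u n) -> (forall n, series u n <= B) -> cvgn (series u).
Proof.
move=> u0 uB; apply: nondecreasing_is_cvgn.
- by apply/nondecreasing_seqP => n; rewrite seriesSr lerDl.
- by exists B => _ [n _ <-].
Qed.

(** The first term is summable along a path with slow steps by the hypothesis of
[square_summable_slow_cvg0], the second one because h ^+ 2 is when h = 1/n: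
hence the cubes of the path have absolutely summable increments. *)
Lemma cube_increment_le (R : realType) (x y h C : R) :
  0 <= h <= 1 -> 0 <= C -> `|y - x| <= C * h ->
  `|y ^+ 3 - x ^+ 3| <= (5 * C) * (x ^+ 2 * h) + (3 * C ^+ 3) * h ^+ 2.
Proof.
move=> /andP[h0 h1] C0 H.
set e := y - x in H.
have -> : y ^+ 3 - x ^+ 3 = e * (3 * x ^+ 2 + 3 * x * e + e ^+ 2) by rewrite /e; ring.
have e2 : e ^+ 2 <= (C * h) ^+ 2.
  by rewrite -(real_normK (num_real e)) lerXn2r // nnegrE ?normr_ge0 // mulr_ge0.
rewrite normrM.
have B : `|3 * x ^+ 2 + 3 * x * e + e ^+ 2| <= 5 * x ^+ 2 + 3 * (C * h) ^+ 2.
  move: e2; set E := (C * h) ^+ 2 => e2.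
  (* (x - e) ^+ 2 and (x + e) ^+ 2 absorb the cross term 3 x e. *)
  have s1 := sqr_ge0 (x - e); have s2 := sqr_ge0 (x + e).
  have s3 := sqr_ge0 x; have s4 := sqr_ge0 e.
  rewrite ler_norml; apply/andP; split; nra.
apply: (le_trans (ler_pM (normr_ge0 _) (normr_ge0 _) H B)).
rewrite mulrDr lerD //; first by rewrite le_eqVlt; apply/orP; left; apply/eqP; ring.
have -> : C * h * (3 * (C * h) ^+ 2) = (3 * C ^+ 3) * h ^+ 2 * h by ring.
by rewrite ler_piMr // mulr_ge0 ?exprn_ge0 // mulr_ge0 ?exprn_ge0.
Qed.

(** The cubes have absolutely summable increments, hence converge. A nonzero
limit would bound |w n| below, and the sum of w n ^+ 2 / n.+1 would dominate a
tail of the harmonic series. The exponent 3 is what turns an increment of size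
1/n into one of size w n ^+ 2 / n. *)
Lemma square_summable_slow_cvg0 (R : realType) (w : R ^nat) (C : R) :
  (forall n, `|w n.+1 - w n| <= C / n.+1%:R) ->
  cvgn (series (fun n => w n ^+ 2 / n.+1%:R)) ->
  w @ \oo --> (0 : R).
Proof.
move=> wC cw.
have C0 : 0 <= C by have := le_trans (normr_ge0 _) (wC 0%N); rewrite divr1.
pose v n := w n ^+ 3.
have cv : cvgn v.
  have cd : cvgn (series (telescope v)).
    apply: normed_cvg.
    apply: (@series_le_cvg _ _
      (fun n => (5 * C) * (w n ^+ 2 / n.+1%:R) + (3 * C ^+ 3) * (n.+1%:R ^+ 2)^-1)).
    - by move=> n /=.
    - move=> n; apply: addr_ge0; apply: mulr_ge0; rewrite ?invr_ge0 ?exprn_ge0 //.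
      + by rewrite mulr_ge0.
      + by rewrite divr_ge0 ?sqr_ge0.
      + by rewrite mulr_ge0 ?exprn_ge0.
    - move=> n /=; rewrite -exprVn; apply: cube_increment_le => //.
      by rewrite invr_ge0 ler0n invf_le1 ?ltr0n // ler1n.
    - have cq : cvgn (series (fun n => (n.+1%:R ^+ 2)^-1 : R)).
        apply: (@nneg_series_bounded_cvg _ _ 2); last exact: sum_inv_sqr_le2.
        by move=> n; rewrite invr_ge0 exprn_ge0.
      have := is_cvg_seriesD (@is_cvg_seriesZ _ _ (5 * C) cw) (@is_cvg_seriesZ _ _ (3 * C ^+ 3) cq).
      by congr (cvgn (series _)); apply/funext.
  have -> : v = (fun n => series (telescope v) n + v 0%N).
    by apply/funext => n; rewrite telescopeK subrK.
  by apply: is_cvgD => //; exact: is_cvg_cst.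
have l0 : limn v = 0.
  apply/eqP/negPn/negP => ln0; apply: (@dvg_harmonic R).
  (* With eta <= 1, eta ^+ 3 <= eta < |w n| ^+ 3 already forces eta <= |w n|,
     so that no cube root is required. *)
  pose eta := Num.min 1 (`|limn v| / 2).
  have eta0 : 0 < eta by rewrite lt_min ltr01 divr_gt0 ?normr_gt0.
  have : \forall n \near \oo, eta < `|v n|.
    have /cvg_norm cnv := cv; apply: (cvgr_gt _ cnv).
    have := normr_gt0 (limn v); rewrite ln0 gt_min => lgt0.
    by apply/orP; right; lra.
  move=> [N _ HN].
  (* The harmonic series with its first N terms erased. *)
  pose e n : R := if (n < N)%N then 0 else harmonic n.
  have ce : cvgn (series e).
    apply: (@series_le_cvg _ _ (eta ^- 2 *: (fun n => w n ^+ 2 / n.+1%:R))).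
    - by move=> n; rewrite /e; case: ifP => // _; exact: harmonic_ge0.
    - move=> n; rewrite mulr_ge0 ?invr_ge0 ?exprn_ge0 ?(ltW eta0) //.
      by rewrite divr_ge0 ?sqr_ge0.
    - move=> n; rewrite /e; case: ltnP => [_|Nn].
        rewrite mulr_ge0 ?invr_ge0 ?exprn_ge0 ?(ltW eta0) //.
        by rewrite divr_ge0 ?sqr_ge0.
      change (n.+1%:R^-1 <= eta ^- 2 * (w n ^+ 2 * n.+1%:R^-1)).
      rewrite mulrA ler_peMl ?invr_ge0 //.
      rewrite mulrC ler_pdivlMr ?exprn_gt0 // mul1r.
      rewrite -[leRHS](real_normK (num_real _)) lerXn2r ?nnegrE ?(ltW eta0) //.
      rewrite leNgt; apply/negP => wn.
      have := HN n Nn; rewrite /= /v normrX ltNge => /negP; apply.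
      rewrite (le_trans _ (_ : eta ^+ 3 <= _)) ?lerXn2r ?nnegrE ?(ltW eta0) ?(ltW wn) //.
      by rewrite exprS ler_piMr ?(ltW eta0) // exprn_ile1 ?(ltW eta0) // ge_min lexx.
    - exact: is_cvg_seriesZ.
  rewrite -(is_cvg_series_restrict N).
  move: ce; rewrite -(is_cvg_series_restrict N).
  have -> // : [sequence \sum_(N <= k < n) harmonic k]_n
             = [sequence \sum_(N <= k < n) e k]_n :> R ^nat.
  apply/funext => n; apply: eq_big_nat => k /andP[Nk _].
  by rewrite /e ltnNge Nk.
apply/cvgr0Pnorm_lt => eps eps0.
have v0 : v @ \oo --> (0 : R) by rewrite -l0.
have /cvgr0Pnorm_lt/(_ (eps ^+ 3)) := v0; move=> /(_ (exprn_gt0 3 eps0)).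
by apply: filterS => n; rewrite normrX ltr_pXn2r ?nnegrE ?(ltW eps0).
Qed.

(** * Discrete random variables *)

(** The real-valued probability, on which field arithmetic is available. *)
Definition rprob disp (Omega : measurableType disp) (R : realType)
    (P : probability Omega R) (A : set Omega) : R := fine (P A).
Arguments rprob {disp Omega R} P A.

Section DiscreteRV.
Set Implicit Arguments.
Context disp (Omega : measurableType disp) (R : realType).
Context (P : probability Omega R).

Local Notation Pr := (rprob P).

Lemma PrK A : measurable A -> (Pr A)%:E = P A.
Proof. by move=> mA; rewrite fineK ?fin_num_measure. Qed.

Lemma measurable_RV_nat (X : {RV P >-> nat}) (A : set nat) : measurable (X @^-1` A).
Proof. exact: measurable_funPTI. Qed.

Lemma measurable_RV_bool (X : {RV P >-> bool}) (A : set bool) : measurable (X @^-1` A).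
Proof. exact: measurable_funPTI. Qed.

Lemma Pr_partition (X : {RV P >-> nat}) M (E : set Omega) : measurable E ->
  (forall w, (X w < M)%N) -> Pr E = \sum_(s < M) Pr (E `&` X @^-1` [set (s : nat)]).
Proof.
move=> mE XM.
have mEs s : measurable (E `&` X @^-1` [set s]).
  by apply: measurableI => //; exact: measurable_RV_nat.
have tE : trivIset setT (fun s => E `&` X @^-1` [set s]).
  by apply: trivIset_setIl; exact: trivIset_preimage1.
apply: EFin_inj; rewrite PrK // -sumEFin (eq_bigr (fun s : 'I_M => P (E `&` X @^-1` [set (s : nat)]))).
  rewrite -(@measure_bigsetU _ _ _ P (fun s => E `&` X @^-1` [set s])) //.
  suff <- : E = \big[setU/set0]_(s < M) (E `&` X @^-1` [set (s : nat)]) by [].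
  rewrite -(bigcup_mkord M (fun s => E `&` X @^-1` [set s])).
  by apply/seteqP; split => [w Ew|w [s _ []//]]; exists (X w) => //=.
by move=> s _; rewrite PrK.
Qed.

Lemma integral_finite_RV (X : {RV P >-> nat}) M (g : nat -> R) :
  (forall w, (X w < M)%N) -> (forall s, 0 <= g s) ->
  (\int[P]_w (g (X w))%:E)%E = (\sum_(s < M) Pr (X @^-1` [set (s : nat)]) * g s)%:E.
Proof.
move=> XM g0.
have mX (s : nat) : measurable (X @^-1` [set s]) by exact: measurable_RV_nat.
transitivity (\int[P]_w (\sum_(s < M) (g s)%:E * (\1_(X @^-1` [set (s : nat)]) w)%:E))%E.
  apply: eq_integral => w _.
  rewrite (bigD1 (Ordinal (XM w))) //= indicE mem_set // mule1 big1 ?adde0 // => s sw.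
  rewrite indicE memNset ?mule0 // => /= e.
  by move: sw; rewrite eq_sym -val_eqE /= e eqxx.
have mI s : measurable_fun setT (fun w => (\1_(X @^-1` [set s]) w)%:E : \bar R).
  by apply/measurable_EFinP; exact: measurable_indic.
rewrite ge0_integral_sum //.
- rewrite -sumEFin; apply: eq_bigr => s _.
  rewrite ge0_integralZl ?lee_fin //.
  by rewrite integral_indic // setIT mulrC EFinM PrK.
- by move=> s; apply: measurable_funeM.
- by move=> s w _; rewrite mule_ge0 ?lee_fin.
Qed.

End DiscreteRV.

(** * From full histories to the current state *)

Section Histories.
Set Implicit Arguments.
Context disp (Omega : measurableType disp) (R : realType).
Context (P : probability Omega R).
Context (Y : nat -> {RV P >-> bool}) (Rn : nat -> {RV P >-> nat}).

Local Notation Pr := (rprob P).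

Lemma measurable_past n r y : measurable (past Y Rn n r y).
Proof.
have -> : past Y Rn n r y = \bigcap_k
    (Rn k @^-1` [set s | (k <= n)%N -> s = r k] `&`
     Y k @^-1` [set b | (k < n)%N -> b = y k]).
  apply/seteqP; split => [w [H1 H2] k _|w H].
    by split => /=; [exact: H1|exact: H2].
  by split => k; [have [+ _] := H k I|have [_ +] := H k I].
apply: bigcapT_measurable => k; apply: measurableI.
- exact: measurable_RV_nat.
- exact: measurable_RV_bool.
Qed.

(** The event that R_n = s is a disjoint union of past events, one for each
history (R_k, Y_k), k < n. Histories are finite sequences over a countable type,
so countable additivity applies once they are numbered by [pickle]. *)
Lemma Pr_disintegration n s (E : set Omega) (q : R) : measurable E ->
  (forall r y, r n = s -> Pr (E `&` past Y Rn n r y) = q * Pr (past Y Rn n r y)) ->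
  Pr (E `&` Rn n @^-1` [set s]) = q * Pr (Rn n @^-1` [set s]).
Proof.
move=> mE H.
pose h w := [seq (Rn k w, Y k w) | k <- iota 0 n].
pose F i := [set w | Rn n w = s /\ pickle (h w) = i].
(* A nonempty block is the past event of any of its points. *)
have FE i : F i = set0 \/ exists r y, r n = s /\ F i = past Y Rn n r y.
  have [->|/set0P[w0 [w0s w0i]]] := eqVneq (F i) set0; first by left.
  right; exists (fun k => Rn k w0), (fun k => Y k w0); split => //.
  apply/seteqP; split => [w [ws wi]|w [H1 H2]].
    have /eq_in_map E0 : h w = h w0.
      by apply: (pcan_inj pickleK); rewrite wi.
    have Ek k : (k < n)%N -> (Rn k w, Y k w) = (Rn k w0, Y k w0).
      by move=> kn; apply: E0; rewrite mem_iota.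
    split => k kn.
      move: kn; rewrite leq_eqVlt => /orP[/eqP ->|/Ek[]//].
      by rewrite ws.
    by have [] := Ek _ kn.
  split; first by rewrite H1.
  rewrite -w0i; congr (pickle _); apply/eq_in_map => k; rewrite mem_iota add0n => /andP[_ kn].
  by rewrite H1 ?H2 // ltnW.
have mF i : measurable (F i).
  by have [->|[r [y [_ ->]]]] := FE i; [exact: measurable0|exact: measurable_past].
have tF : trivIset setT F.
  by apply/trivIsetP => i j _ _ ij; apply/seteqP; split => // w [[_ ei] [_ ej]]; rewrite -ei -ej eqxx in ij.
have UF : Rn n @^-1` [set s] = \bigcup_i F i.
  apply/seteqP; split => [w ws|w [i _ []//]].
  by exists (pickle (h w)).
have mR : measurable (Rn n @^-1` [set s]) by exact: measurable_RV_nat.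
apply: EFin_inj; rewrite EFinM !PrK //; last exact: measurableI.
rewrite UF setI_bigcupr !measure_bigcup //.
- rewrite -nneseriesZl; last by move=> i _; exact: measure_ge0.
  apply: eq_eseriesr => i _.
  have [->|[r [y [rn ->]]]] := FE i; first by rewrite setI0 measure0 mule0.
  have mp := measurable_past n r y.
  have := congr1 EFin (H r y rn).
  by rewrite EFinM !PrK //; exact: measurableI.
- by move=> i _; exact: measurableI.
- exact: trivIset_setIl.
Qed.

(** Y_n is independent of the past, so its two values split each past event in
the proportions theta and 1 - theta; on either part the conditional probability
of E only depends on the current state and the player. Null present events, where
the conditional probability is a division by 0, have to be treated apart. *)
Lemma Pr_mixture theta n s (E : set Omega) (k : bool -> R) : 0 <= theta <= 1 ->
  measurable E ->
  (forall A, distribution P (Y n) A = bernoulli_prob theta A) ->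
  (forall r y (A : set bool), P (past Y Rn n r y `&` (Y n @^-1` A)) =
    (P (past Y Rn n r y) * P (Y n @^-1` A))%E) ->
  (forall r y, r n = s -> (0 < P (present Y Rn n r y))%E ->
    cond_prob P E (present Y Rn n r y) = k (y n)) ->
  Pr (E `&` Rn n @^-1` [set s]) =
    (theta * k true + (1 - theta) * k false) * Pr (Rn n @^-1` [set s]).
Proof.
move=> th01 mE bY indY kE.
apply: Pr_disintegration => // r y rs.
have PY b : Pr (Y n @^-1` [set b]) = if b then theta else 1 - theta.
  have -> : Pr (Y n @^-1` [set b]) = fine (bernoulli_prob theta [set b]).
    by rewrite -(bY [set b]).
  rewrite bernoulli_probE // !diracE; case: b => /=.
    by rewrite mem_set // memNset //= mulr0 mulr1 addr0.
  by rewrite memNset // mem_set //= mulr0 mulr1 add0r.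
(* The past up to time n does not constrain Y_n: its value can be prescribed. *)
pose z b k := if k == n then b else y k.
have pz b : past Y Rn n r (z b) = past Y Rn n r y.
  apply/seteqP; split=> w [H1 H2]; split => // j jn; move: (H2 j jn);
  by rewrite /z (ltn_eqF jn).
have zn b : z b n = b by rewrite /z eqxx.
have mp := measurable_past n r y.
have mY b : measurable (Y n @^-1` [set b]) by exact: measurable_RV_bool.
have part b : Pr (E `&` past Y Rn n r y `&` Y n @^-1` [set b]) =
    (if b then theta else 1 - theta) * k b * Pr (past Y Rn n r y).
  have : Pr (present Y Rn n r (z b)) = Pr (past Y Rn n r y) * Pr (Y n @^-1` [set b]).
    by rewrite /rprob /present indY fineM ?fin_num_measure // ?pz ?zn //.
  have presE : present Y Rn n r (z b) = past Y Rn n r y `&` Y n @^-1` [set b].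
    by rewrite /present pz zn.
  have mpres : measurable (present Y Rn n r (z b)) by rewrite presE; exact: measurableI.
  rewrite PY -setIA -presE => PP.
  rewrite -[_ * k b]mulrC -mulrA -[_ * Pr _]mulrC -PP.
  have [P0|P0] := eqVneq (Pr (present Y Rn n r (z b))) 0.
    rewrite P0 mulr0; apply/eqP; rewrite eq_le; apply/andP; split.
      rewrite -P0 -lee_fin !PrK //; last exact: measurableI.
      by apply: le_measure; rewrite ?inE //; exact: measurableI.
    by apply: fine_ge0; exact: measure_ge0.
  have Ppos : (0 < P (present Y Rn n r (z b)))%E.
    by rewrite -PrK // lte_fin lt_neqAle eq_sym P0 fine_ge0.
  have := kE r (z b) rs Ppos; rewrite zn /cond_prob => <-.
  by rewrite divfK.
rewrite mulrDl -(part true) -(part false).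
have mEp : measurable (E `&` past Y Rn n r y) by exact: measurableI.
apply: EFin_inj; rewrite EFinD !PrK //; try exact: measurableI.
rewrite (measureDI P mEp (mY true)) addeC.
have -> // : E `&` past Y Rn n r y `\` Y n @^-1` [set true] =
  E `&` past Y Rn n r y `&` Y n @^-1` [set false].
apply/seteqP; split => w [Hw]; rewrite /= => yw; split => //=.
  by case: (Y n w) yw.
by rewrite yw.
Qed.

End Histories.

(** * One step of the urn *)

(** Here z is the deviation R_n - rho T_n, and al, ga are its two possible
increments, taken with probabilities q and 1 - q and of mean lam z / T. After
multiplication by (T + K) ^+ 2, the two sides differ by a sum of squares with
nonnegative coefficients. *)
Lemma quadratic_drift (R : realType) (q T K lam z al ga : R) :
  0 <= q <= 1 -> 0 < T -> 0 <= K -> q * al + (1 - q) * ga = lam * (z / T) ->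
  q * ((z + al) / (T + K)) ^+ 2 + (1 - q) * ((z + ga) / (T + K)) ^+ 2 <=
  (z / T) ^+ 2 - 2 * (K - lam) * (T / (T + K) ^+ 2) * (z / T) ^+ 2
    + (al ^+ 2 + ga ^+ 2) / (T + K) ^+ 2.
Proof.
move=> /andP[q0 q1] T0 K0; set x := z / T => drift.
have zx : z = x * T by rewrite /x divfK // gt_eqF.
clearbody x.
have T'0 : 0 < T + K by lra.
rewrite !expr_div_n -subr_ge0.
have -> : x ^+ 2 - 2 * (K - lam) * (T / (T + K) ^+ 2) * x ^+ 2 +
    (al ^+ 2 + ga ^+ 2) / (T + K) ^+ 2 -
    (q * ((z + al) ^+ 2 / (T + K) ^+ 2) + (1 - q) * ((z + ga) ^+ 2 / (T + K) ^+ 2)) =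
  ((x * K) ^+ 2 + (1 - q) * al ^+ 2 + q * ga ^+ 2
   + 2 * x * T * (lam * x - (q * al + (1 - q) * ga))) / (T + K) ^+ 2.
  by rewrite zx; field; rewrite gt_eqF.
rewrite drift subrr mulr0 addr0 divr_ge0 ?exprn_ge0 ?(ltW T'0) //.
have q1' : 0 <= 1 - q by lra.
by rewrite !addr_ge0 ?sqr_ge0 // mulr_ge0 ?sqr_ge0.
Qed.

Section Urn.
Set Implicit Arguments.
Context disp (Omega : measurableType disp) (R : realType).
Context (P : probability Omega R) (p theta : R) (a b c d R0 B0 K : nat).
Context (Y : nat -> {RV P >-> bool}) (Rn Bn : nat -> {RV P >-> nat}).
Context (p01 : 0 <= p <= 1) (th01 : 0 <= theta <= 1).
Context (urn_tenable : tenable a b c d R0 B0 K).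
Context (urn : two_strategy_urn p theta a c R0 B0 K Y Rn Bn).

Local Notation Pr := (rprob P).

Local Notation tot := (total_balls R0 B0 K).

Local Notation T n := ((total_balls R0 B0 K n)%:R : R).

Definition red_step_prob n s : R := 1 - p + (2 * p - 1) * theta * (s%:R / T n).

Lemma red_le_total n w : (Rn n w <= tot n)%N.
Proof. by rewrite -(urn_total urn n w) leq_addr. Qed.

Local Hint Extern 0 (measurable (_ @^-1` _)) => exact: measurable_RV_nat : core.

Lemma Pr_red_step n s : Pr (Rn n.+1 @^-1` [set (s + a)%N] `&` Rn n @^-1` [set s]) =
  red_step_prob n s * Pr (Rn n @^-1` [set s]).
Proof.
have [indY bY] := urn_strategy urn.
rewrite (@Pr_mixture _ _ _ P Y Rn theta n s _ (fun y => red_prob p y s (tot n))) //.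
- by congr (_ * _); rewrite /red_prob /red_step_prob /=; ring.
- exact: urn_independent urn n.
- by move=> r y <- Ppos; rewrite (urn_red urn).
Qed.

Lemma Pr_blue_step n s : Pr (Rn n.+1 @^-1` [set (s + c)%N] `&` Rn n @^-1` [set s]) =
  (1 - red_step_prob n s) * Pr (Rn n @^-1` [set s]).
Proof.
have [indY bY] := urn_strategy urn.
rewrite (@Pr_mixture _ _ _ P Y Rn theta n s _ (fun y => 1 - red_prob p y s (tot n))) //.
- by congr (_ * _); rewrite /red_prob /red_step_prob /=; ring.
- exact: urn_independent urn n.
- by move=> r y <- Ppos; rewrite (urn_blue urn) // (urn_red urn).
Qed.

(** The conditional probabilities of the two prescribed steps already add up to
1, and as a <> c these are disjoint events, so nothing is left for other steps. *)
Lemma Pr_other_step n s t : t <> (s + a)%N -> t <> (s + c)%N ->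
  Pr (Rn n.+1 @^-1` [set t] `&` Rn n @^-1` [set s]) = 0.
Proof.
move=> ta tc.
pose E := Rn n.+1 @^-1` [set (s + a)%N] `&` Rn n @^-1` [set s].
pose F := Rn n.+1 @^-1` [set (s + c)%N] `&` Rn n @^-1` [set s].
pose G := Rn n.+1 @^-1` [set t] `&` Rn n @^-1` [set s].
have mE : measurable E by exact: measurableI.
have mF : measurable F by exact: measurableI.
have mG : measurable G by exact: measurableI.
have EF : E `&` F = set0.
  apply/seteqP; split => // w [[/= e1 _] [/= e2 _]].
  by apply: (tenable_neq urn_tenable); apply/eqP; rewrite -(eqn_add2l s) -e1 e2.
have EFG : (E `|` F) `&` G = set0.
  by apply/seteqP; split => // w [[[/= e1 _]|[/= e1 _]] [/= e2 _]];
    [apply: ta|apply: tc]; rewrite -e1 -e2.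
have : Pr (E `|` F `|` G) <= Pr (Rn n @^-1` [set s]).
  rewrite -lee_fin !PrK //; last by repeat apply: measurableU.
  apply: le_measure; rewrite ?inE //; first by repeat apply: measurableU.
  by move=> w [[[]|[]]|[]].
have -> : Pr (E `|` F `|` G) = Pr E + Pr F + Pr G.
  apply: EFin_inj; rewrite !EFinD !PrK //; last by repeat apply: measurableU.
  by rewrite measureU ?measureU //; exact: measurableU.
rewrite Pr_red_step Pr_blue_step => H.
apply/eqP; rewrite eq_le fine_ge0 // andbT -/G; lra.
Qed.

Lemma Pr_step n s t : Pr (Rn n.+1 @^-1` [set t] `&` Rn n @^-1` [set s]) =
  (t == s + a)%N%:R * (red_step_prob n s * Pr (Rn n @^-1` [set s])) +
  (t == s + c)%N%:R * ((1 - red_step_prob n s) * Pr (Rn n @^-1` [set s])).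
Proof.
have ac : (s + a == s + c)%N = false.
  by rewrite eqn_add2l; apply/eqP; exact: tenable_neq urn_tenable.
have [->|/eqP ta] := eqVneq t (s + a)%N; first by rewrite ac mul1r mul0r addr0 Pr_red_step.
have [->|/eqP tc] := eqVneq t (s + c)%N; first by rewrite mul1r mul0r add0r Pr_blue_step.
by rewrite !mul0r addr0 Pr_other_step.
Qed.

Lemma ae_step : {ae P, forall w, forall n,
  Rn n.+1 w = (Rn n w + a)%N \/ Rn n.+1 w = (Rn n w + c)%N}.
Proof.
apply: ae_foralln => n.
have : {ae P, forall w, forall s, forall t, t <> (s + a)%N -> t <> (s + c)%N ->
   ~ (Rn n.+1 w = t /\ Rn n w = s)}.
  apply: ae_foralln => s; apply: ae_foralln => t.
  have [ta|ta] := eqVneq t (s + a)%N; first by apply: nearW => w /(_ ta).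
  have [tc|tc] := eqVneq t (s + c)%N; first by apply: nearW => w _ /(_ tc).
  exists (Rn n.+1 @^-1` [set t] `&` Rn n @^-1` [set s]); split.
  - exact: measurableI.
  - have <- : (Pr (Rn n.+1 @^-1` [set t] `&` Rn n @^-1` [set s]))%:E = 0%E.
      by rewrite Pr_other_step //; exact/eqP.
    by rewrite PrK //; exact: measurableI.
  - by move=> w /= /not_implyP[_ /not_implyP[_ /contrapT]].
apply: filterS => w H.
apply: contrapT => /not_orP[ta tc].
exact: H ta tc _.
Qed.

Lemma moment_step n (g : nat -> R) :
  \sum_(t < (tot n.+1).+1) g t * Pr (Rn n.+1 @^-1` [set (t : nat)]) =
  \sum_(s < (tot n).+1) Pr (Rn n @^-1` [set (s : nat)]) *
    (red_step_prob n s * g (s + a)%N + (1 - red_step_prob n s) * g (s + c)%N).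
Proof.
under eq_bigr => t _.
  rewrite (@Pr_partition _ _ _ P (Rn n) (tot n).+1) //; last by move=> w; exact: red_le_total.
  rewrite mulr_sumr.
  over.
rewrite exchange_big /=; apply: eq_bigr => s _.
under eq_bigr => t _ do rewrite Pr_step mulrDr.
rewrite big_split /=.
have pick k (x : R) : (k <= K)%N ->
    \sum_(t < (tot n.+1).+1) g t * ((t == s + k :> nat)%N%:R * x) = g (s + k)%N * x.
  move=> kK.
  have sk : (s + k < (tot n.+1).+1)%N.
    rewrite ltnS (_ : tot n.+1 = tot n + K)%N; last by rewrite /total_balls mulnS; ring.
    by apply: leq_add => //; rewrite -ltnS.
  rewrite (bigD1 (Ordinal sk)) //= eqxx mul1r big1 ?addr0 // => t tne.
  suff -> : (t == s + k :> nat)%N = false by rewrite mul0r mulr0.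
  by apply/negbTE; apply: contra tne => /eqP e; apply/eqP/val_inj.
have [_ _ abK cdK _] := urn_tenable.
rewrite !pick; last 2 first.
- by rewrite -cdK leq_addr.
- by rewrite -abK leq_addr.
ring.
Qed.

(** * Second moments of the deviation *)

(** The rate lam in the mean increment mu + lam * X_n of R_n. *)
Definition drift_coef : R := theta * (2 * p - 1) * (a%:R - c%:R).

(** The rest point of the mean motion, solving mu + lam * rho = K * rho. *)
Definition red_limit : R := (p * c%:R + (1 - p) * a%:R) / (K%:R - drift_coef).

Definition deviation n s : R := (s%:R - red_limit * T n) / T n.

(** E[W_n^2], as a finite sum over the possible values of R_n. *)
Definition deviation_moment n : R :=
  \sum_(s < (tot n).+1) Pr (Rn n @^-1` [set (s : nat)]) * deviation n s ^+ 2.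

Context (sub : drift_coef < K%:R).

Lemma total_ge n : n.+1%:R <= T n.
Proof.
have [h0 h1 _ _ _] := urn_tenable.
rewrite ler_nat /total_balls -addn1; apply: leq_add => //.
by rewrite leq_pmull.
Qed.

Lemma total_gt0 n : 0 < T n.
Proof. by rewrite (lt_le_trans _ (total_ge n)) // ltr0n. Qed.

Lemma total_le n : T n <= (K + (R0 + B0))%:R * n.+1%:R.
Proof.
rewrite -natrM ler_nat /total_balls mulnDl mulnS.
apply: leq_add; first exact: leq_addl.
by rewrite leq_pmulr.
Qed.

Lemma totalS n : T n.+1 = T n + K%:R.
Proof. by rewrite /total_balls -natrD mulnS -addnA addnC. Qed.

Lemma red_step_prob01 n s : (s <= tot n)%N -> 0 <= red_step_prob n s <= 1.
Proof.
move=> st; have T0 := total_gt0 n; rewrite /red_step_prob.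
have x0 : 0 <= s%:R / T n by rewrite divr_ge0.
have x1 : s%:R / T n <= 1 by rewrite ler_pdivrMr // mul1r ler_nat.
move: x0 x1; set x := s%:R / T n => x0 x1.
have /andP[p0 p1] := p01; have /andP[t0 t1] := th01.
have tx0 : 0 <= theta * x by rewrite mulr_ge0.
have tx1 : theta * x <= 1 by rewrite mulr_ile1.
by rewrite -mulrA; move: tx0 tx1; set u := theta * x => u0 u1; apply/andP; split; nra.
Qed.

Lemma deviation_moment_step n :
  deviation_moment n.+1 <= deviation_moment n
    - 2 * (K%:R - drift_coef) * (T n / T n.+1 ^+ 2) * deviation_moment n
    + ((a%:R - red_limit * K%:R) ^+ 2 + (c%:R - red_limit * K%:R) ^+ 2) / T n.+1 ^+ 2.
Proof.
set C := _ ^+ 2 + _ ^+ 2; set D := 2 * _ * _.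
have -> : deviation_moment n.+1 =
    \sum_(t < (tot n.+1).+1) deviation n.+1 t ^+ 2 * Pr (Rn n.+1 @^-1` [set (t : nat)]).
  by apply: eq_bigr => t _; rewrite mulrC.
rewrite (moment_step n (fun s => deviation n.+1 s ^+ 2)).
have -> : deviation_moment n - D * deviation_moment n + C / T n.+1 ^+ 2 =
  \sum_(s < (tot n).+1) Pr (Rn n @^-1` [set (s : nat)]) *
     (deviation n s ^+ 2 - D * deviation n s ^+ 2 + C / T n.+1 ^+ 2).
  have P1 : \sum_(s < (tot n).+1) Pr (Rn n @^-1` [set (s : nat)]) = 1.
    have := @Pr_partition _ _ _ P (Rn n) (tot n).+1 setT measurableT (fun w => red_le_total n w).
    rewrite /rprob probability_setT /= => ->.
    by apply: eq_bigr => s _; rewrite setTI.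
  rewrite -[C / _]mul1r -{1}P1 /deviation_moment mulr_sumr mulr_suml -sumrB -big_split /=.
  by apply: eq_bigr => s _; ring.
apply: ler_sum => s _; apply: ler_wpM2l; first exact: fine_ge0.
have sT : (s <= tot n)%N by rewrite -ltnS.
have T0 := total_gt0 n.
rewrite /D totalS.
have step (k : nat) : deviation n.+1 (s + k)%N =
   (s%:R - red_limit * T n + (k%:R - red_limit * K%:R)) / (T n + K%:R).
  by rewrite /deviation totalS natrD; congr (_ / _); ring.
rewrite !step; apply: quadratic_drift => //; first exact: red_step_prob01.
have KD : K%:R - drift_coef != 0 by rewrite subr_eq0 gt_eqF.
rewrite /red_step_prob /red_limit.
have -> : (s%:R - (p * c%:R + (1 - p) * a%:R) / (K%:R - drift_coef) * T n) / T n =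
  s%:R / T n - (p * c%:R + (1 - p) * a%:R) / (K%:R - drift_coef).
  by field; rewrite KD gt_eqF.
set x := s%:R / T n.
by move: KD; rewrite /drift_coef => KD; field.
Qed.

(** [deviation_moment_step] telescopes. The sum is stated with the weights
1 / k.+1: since T_k lies between k.+1 and M * k.+1, they are comparable to the
contraction T_k / T_{k+1} ^+ 2 of the k-th step. *)
Lemma summable_moments : exists B : R, forall n,
  \sum_(0 <= k < n) deviation_moment k / k.+1%:R <= B.
Proof.
pose C := (a%:R - red_limit * K%:R) ^+ 2 + (c%:R - red_limit * K%:R) ^+ 2.
have C0 : 0 <= C by rewrite addr_ge0 ?sqr_ge0.
pose M : R := (K + (R0 + B0))%:R.
have M0 : 0 < M.
  by rewrite ltr0n; have [h0 h1 _ _ _] := urn_tenable; rewrite addn_gt0 h1.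
(* 2 (K - lam) / (4 M ^+ 2), where 4 comes from n.+2 <= 2 * n.+1, squared. *)
pose del := (K%:R - drift_coef) / (2 * M ^+ 2).
have del0 : 0 < del by rewrite divr_gt0 ?subr_gt0 // mulr_gt0 // exprn_gt0.
have m0 n : 0 <= deviation_moment n.
  by apply: sumr_ge0 => s _; rewrite mulr_ge0 ?sqr_ge0 // fine_ge0.
have H n : del * \sum_(0 <= k < n) deviation_moment k / k.+1%:R <=
   deviation_moment 0%N - deviation_moment n + C * \sum_(0 <= k < n) (k.+1%:R ^+ 2)^-1.
  elim: n => [|n IH]; first by rewrite !big_nil !mulr0 subrr addr0.
  rewrite !big_nat_recr //= !mulrDr.
  suff S : del * (deviation_moment n / n.+1%:R) <=
     deviation_moment n - deviation_moment n.+1 + C * (n.+1%:R ^+ 2)^-1.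
    apply: le_trans (lerD IH S) _.
    move: (deviation_moment 0) (deviation_moment n) (deviation_moment n.+1) => m1 m2 m3.
    by move: (C * _) (C * _) => x y; lra.
  have := deviation_moment_step n; rewrite -/C.
  have c1 : C / T n.+1 ^+ 2 <= C * (n.+1%:R ^+ 2)^-1.
    apply: ler_wpM2l => //; rewrite lef_pV2 ?posrE ?exprn_gt0 ?total_gt0 ?ltr0n //.
    rewrite lerXn2r ?nnegrE ?(ltW (total_gt0 _)) //.
    by rewrite (le_trans _ (total_ge _)) // ler_nat.
  have c2 : del * (deviation_moment n / n.+1%:R) <=
     2 * (K%:R - drift_coef) * (T n / T n.+1 ^+ 2) * deviation_moment n.
    rewrite [deviation_moment n / _]mulrC mulrA; apply: ler_wpM2r => //.
    have -> : del / n.+1%:R = (K%:R - drift_coef) * (n.+1%:R^-1 / (2 * M ^+ 2)).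
      by rewrite /del mulrAC -mulrA.
    have -> : 2 * (K%:R - drift_coef) * (T n / T n.+1 ^+ 2) =
        (K%:R - drift_coef) * (2 * (T n / T n.+1 ^+ 2)).
      by rewrite mulrAC [RHS]mulrC.
    apply: ler_wpM2l.
      by rewrite subr_ge0 ltW.
    have n0 : (0 : R) < n.+1%:R by rewrite ltr0n.
    have t1 := total_ge n; have t2 := total_le n.+1; have t3 := total_gt0 n.+1.
    have n2 : n.+2%:R <= 2 * n.+1%:R :> R by rewrite -natrM ler_nat mul2n -addnn addSn ltnS leq_addl.
    have t4 : T n.+1 ^+ 2 <= (M * (2 * n.+1%:R)) ^+ 2.
      rewrite lerXn2r ?nnegrE ?(ltW t3) //.
        by rewrite !mulr_ge0 // ltW.
      by rewrite (le_trans t2) // ler_wpM2l // ltW.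
    rewrite mulrA ler_pdivlMr ?exprn_gt0 //.
    have -> : n.+1%:R^-1 * (2 * M ^+ 2)^-1 * T n.+1 ^+ 2 =
       T n.+1 ^+ 2 / (n.+1%:R * (2 * M ^+ 2)) by rewrite [RHS]mulrC -invfM.
    rewrite ler_pdivrMr; last by rewrite !mulr_gt0 // exprn_gt0.
    rewrite (le_trans t4) //.
    have -> : (M * (2 * n.+1%:R)) ^+ 2 = n.+1%:R * (2 * n.+1%:R * (2 * M ^+ 2)) by ring.
    have -> : 2 * T n * (n.+1%:R * (2 * M ^+ 2)) = T n * (2 * n.+1%:R * (2 * M ^+ 2)) by ring.
    by apply: ler_wpM2r => //; rewrite !mulr_ge0 // ?(ltW n0) // exprn_ge0 // ltW.
  move: c1 c2; move: (deviation_moment n) (deviation_moment n.+1) => m2 m3.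
  by move: (del * _) (_ * m2) (C / _) (C * _) => x y z u; lra.
exists ((deviation_moment 0%N + C * 2) / del) => n.
rewrite ler_pdivlMr // mulrC (le_trans (H n)) // lerD //; first by rewrite gerBl.
by rewrite ler_wpM2l // sum_inv_sqr_le2.
Qed.

(** * Almost sure convergence *)

(** The expectation of the sum is the sum of the moments, which is finite; so
the sum is almost surely finite. *)
Lemma ae_summable_deviation :
  {ae P, forall w, cvgn (series (fun n => deviation n (Rn n w) ^+ 2 / n.+1%:R))}.
Proof.
have [B HB] := summable_moments.
pose f n w : \bar R := (deviation n (Rn n w) ^+ 2 / n.+1%:R)%:E.
have f0 n w : (0 <= f n w)%E by rewrite lee_fin divr_ge0 ?sqr_ge0.
have mf n : measurable_fun setT (f n).
  move=> _ A mA; rewrite setTI.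
  exact: (measurable_RV_nat (Rn n) [set s | A (deviation n s ^+ 2 / n.+1%:R)%:E]).
have If n : (\int[P]_w f n w)%E = (deviation_moment n / n.+1%:R)%:E.
  rewrite (@integral_finite_RV _ _ _ P (Rn n) (tot n).+1
    (fun s => deviation n s ^+ 2 / n.+1%:R)) //.
  - by rewrite /deviation_moment mulr_suml; congr (_%:E); apply: eq_bigr => s _; rewrite mulrA.
  - by move=> w; exact: red_le_total.
  - by move=> s; rewrite divr_ge0 ?sqr_ge0.
have IF : (\int[P]_w \sum_(n <oo) f n w <= B%:E)%E.
  rewrite integral_nneseries //.
  apply: lime_le.
    by apply: is_cvg_nneseries => n _ _; exact: integral_ge0.
  apply: nearW => n; rewrite (eq_bigr (fun k => (deviation_moment k / k.+1%:R)%:E)) //.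
  by rewrite sumEFin lee_fin.
have F0 w : (0 <= \sum_(n <oo) f n w)%E by exact: nneseries_ge0.
have iF : P.-integrable setT (fun w => \sum_(n <oo) f n w)%E.
  apply/integrableP; split.
    exact: ge0_emeasurable_sum.
  apply: le_lt_trans (ltry B); apply: le_trans IF.
  by under eq_integral => w _ do rewrite gee0_abs //.
have := @integrable_ae _ _ _ P _ measurableT _ iF.
apply: filterS => w /(_ I) Fw.
apply: (@nneg_series_bounded_cvg _ _ (fine (\sum_(n <oo) f n w)%E)).
- by move=> n; rewrite divr_ge0 ?sqr_ge0.
- move=> n; rewrite -lee_fin fineK // -sumEFin.
  by apply: (@nneseries_lim_ge _ (fun n => f n w) xpredT 0%N n) => k _ _; exact: f0.
Qed.

(** The new deviation is W_{n+1} = W_n + (k - rho K - W_n K) / T_{n+1} when k red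
balls are added, and |W_n| <= 1 + |rho| since X_n lies in [0, 1]. *)
Lemma deviation_slow n w :
  Rn n.+1 w = (Rn n w + a)%N \/ Rn n.+1 w = (Rn n w + c)%N ->
  `|deviation n.+1 (Rn n.+1 w) - deviation n (Rn n w)|
    <= (2 * K%:R * (1 + `|red_limit|)) / n.+1%:R.
Proof.
move=> H.
have [_ _ abK cdK _] := urn_tenable.
have [k [kK ->]] : exists k, (k <= K)%N /\ Rn n.+1 w = (Rn n w + k)%N.
  case: H => ->; [exists a|exists c]; split => //.
    by rewrite -abK leq_addr.
  by rewrite -cdK leq_addr.
have T0 := total_gt0 n; have T1 := total_gt0 n.+1.
set rho := red_limit; set x := deviation n (Rn n w).
have -> : deviation n.+1 (Rn n w + k)%N - x = (k%:R - rho * K%:R - x * K%:R) / T n.+1.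
  rewrite /x /deviation -/rho totalS natrD; field.
  by rewrite -totalS !gt_eqF.
have x1 : `|x| <= 1 + `|rho|.
  rewrite /x /deviation mulrBl mulfK ?gt_eqF // (le_trans (ler_normB _ _)) // lerD2r.
  rewrite ger0_norm ?divr_ge0 ?(ltW T0) // ler_pdivrMr // mul1r ler_nat.
  exact: red_le_total.
have num : `|k%:R - rho * K%:R - x * K%:R| <= 2 * K%:R * (1 + `|rho|).
  rewrite (le_trans (ler_normB _ _)) //.
  have -> : 2 * K%:R * (1 + `|rho|) = (K%:R + `|rho| * K%:R) + (1 + `|rho|) * K%:R by ring.
  rewrite lerD //; last by rewrite normrM normr_nat ler_wpM2r.
  by rewrite (le_trans (ler_normB _ _)) // lerD // ?normrM ?normr_nat // ler_nat.
rewrite normrM normfV (gtr0_norm T1) ler_pM ?invr_ge0 ?(ltW T1) //.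
rewrite lef_pV2 ?posrE ?T1 ?ltr0n //.
by rewrite (le_trans _ (total_ge _)) // ler_nat.
Qed.

Lemma ae_red_fraction_cvg :
  {ae P, forall w, (fun n => (Rn n w)%:R / T n) @ \oo --> red_limit}.
Proof.
apply: filterS2 ae_step ae_summable_deviation => w st sm.
have := square_summable_slow_cvg0 _ _ _ (fun n => @deviation_slow n w (st n)) sm.
have -> : (fun n => (Rn n w)%:R / T n) = (fun n => red_limit + deviation n (Rn n w)).
  apply/funext => n.
  by rewrite /deviation mulrBl mulfK ?gt_eqF ?total_gt0 // addrC subrK.
by move=> /(cvgD (cvg_cst red_limit)); rewrite addr0; exact.
Qed.

End Urn.

Theorem theorem2p2 (disp : measure_display) (Omega : measurableType disp)
    (R : realType) (P : probability Omega R) (p theta : R)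
    (a b c d R0 B0 K : nat)
    (Y : nat -> {RV P >-> bool}) (Rn Bn : nat -> {RV P >-> nat}) :
  0 <= p <= 1 -> 0 <= theta <= 1 ->
  tenable a b c d R0 B0 K ->
  two_strategy_urn p theta a c R0 B0 K Y Rn Bn ->
  theta * (2 * p - 1) * (a%:R - c%:R) < K%:R ->
  {ae P, forall w,
    (fun n => ((Rn n w)%:R / (total_balls R0 B0 K n)%:R : R,
               (Bn n w)%:R / (total_balls R0 B0 K n)%:R : R)) @ \oo -->
    ((p * c%:R + (1 - p) * a%:R) /
       (K%:R - theta * (2 * p - 1) * (a%:R - c%:R)),
     (K%:R - c%:R - (a%:R - c%:R) * (theta * (2 * p - 1) + (1 - p))) /
       (K%:R - theta * (2 * p - 1) * (a%:R - c%:R)))}.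
Proof.
move=> p01 th01 ten urn sub.
have := ae_red_fraction_cvg p01 th01 ten urn sub.
apply: filterS => w redw.
have blueE : (fun n => (Bn n w)%:R / (total_balls R0 B0 K n)%:R : R) =
    (fun n => 1 - (Rn n w)%:R / (total_balls R0 B0 K n)%:R).
  apply/funext => n.
  have T0 : (0 : R) < (total_balls R0 B0 K n)%:R by exact: total_gt0 ten n.
  apply/eqP; rewrite -subr_eq0 opprB addrA -mulrDl; apply/eqP.
  by rewrite -natrD [X in X%:R / _]addnC (urn_total urn) divff ?subrr // gt_eqF.
have blue_limitE : (K%:R - c%:R - (a%:R - c%:R) * (theta * (2 * p - 1) + (1 - p))) /
    (K%:R - theta * (2 * p - 1) * (a%:R - c%:R)) =
    1 - red_limit R p theta a c K.
  by rewrite /red_limit /drift_coef; field; rewrite subr_eq0 gt_eqF.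
have bluew : (fun n => (Bn n w)%:R / (total_balls R0 B0 K n)%:R : R) @ \oo -->
    1 - red_limit R p theta a c K.
  by rewrite blueE; apply: cvgB redw; exact: cvg_cst.
rewrite blue_limitE.
exact: cvg_pair redw bluew.
Qed.
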